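(* Let $U\subseteq S^m$ be open and let $f:U\to\mathbb{R}$ be a smooth function. Let $f\left(\frac{x}{|x|}\right)$ denote the function $x\mapsto f(x/|x|)$ defined on the open set $\{x\in\mathbb{R}^{m+1}\setminus\{0\} : x/|x|\in U\}$. Then on $U$ $$\Delta^2_{S^m} f= \left(\Delta^2_{\mathbb{R}^{m+1}}f\left( \tfrac{x}{|x|}\right)\right)\Big|_{S^m}+2(m-3)\,\Delta_{S^m} f,$$ or, equivalently, $$\Delta^2_{S^m} f= \left(\Delta^2_{\mathbb{R}^{m+1}}f\left( \tfrac{x}{|x|}\right)+2(m-3)\,\Delta_{\mathbb{R}^{m+1}} f\left( \tfrac{x}{|x|}\right)\right)\Big|_{S^m},$$ where $|_{S^m}$ denotes evaluation at points $x$ with $|x|=1$, $x\in U$.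
   Context: $S^m\subset\mathbb{R}^{m+1}$ is the unit sphere with its standard round metric. The Laplacian on a Riemannian manifold is $\Delta f=\operatorname{div}(\nabla f)$ and the bi-Laplacian is $\Delta^2 f=\Delta(\Delta f)$. $\Delta_{S^m}$ and $\Delta_{\mathbb{R}^{m+1}}$ are the Laplacians of the round sphere and of Euclidean space. *)

(* Defs.v *)
From HB Require Import structures.
From mathcomp Require Import all_boot all_order all_algebra.
From mathcomp Require Import all_classical all_reals all_analysis.

Set Implicit Arguments.
Unset Strict Implicit.
Unset Printing Implicit Defensive.

Import Order.TTheory GRing.Theory Num.Theory.
Import numFieldNormedType.Exports.

Local Open Scope classical_set_scope.
Local Open Scope ring_scope.

(* The library norm `|x| on 'rV[R]_n is the sup norm (same topology), so the
   Euclidean inner product and norm are introduced here. *)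
Definition dot (R : realType) (n : nat) (u v : 'rV[R]_n) : R :=
  \sum_i u 0 i * v 0 i.

Definition enorm (R : realType) (n : nat) (u : 'rV[R]_n) : R :=
  Num.sqrt (dot u u).

Definition sphere (R : realType) (m : nat) : set 'rV[R]_m.+1 :=
  [set x | enorm x = 1].
Arguments sphere : clear implicits.

Definition open_in_sphere (R : realType) (m : nat) (U : set 'rV[R]_m.+1) :=
  exists2 O : set 'rV[R]_m.+1, open O & U = O `&` sphere R m.

(* The functions on an open set W of R^(m+1), or on an open set U of S^m, are
   represented by total functions on 'rV[R]_m.+1; their values outside W
   (resp. U) are irrelevant to all the notions below. *)

Definition partial (R : realType) (m : nat) (i : 'I_m.+1)
    (F : 'rV[R]_m.+1 -> R) : 'rV[R]_m.+1 -> R :=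
  fun x => 'D_(delta_mx 0 i) F x.

Definition smooth_on (R : realType) (m : nat) (W : set 'rV[R]_m.+1)
    (F : 'rV[R]_m.+1 -> R) : Prop :=
  forall (s : seq 'I_m.+1) (x : 'rV[R]_m.+1), W x ->
    differentiable (foldr (@partial R m) F s) x.

(* Smoothness on a subset of a Euclidean space: local smooth extendability. *)
Definition sphere_smooth_on (R : realType) (m : nat) (U : set 'rV[R]_m.+1)
    (f : 'rV[R]_m.+1 -> R) : Prop :=
  forall p, U p ->
    exists (W : set 'rV[R]_m.+1) (F : 'rV[R]_m.+1 -> R),
      [/\ open W, W p, smooth_on W F & forall x, W x -> U x -> F x = f x].

Definition euclid_grad (R : realType) (m : nat) (F : 'rV[R]_m.+1 -> R)
    (x : 'rV[R]_m.+1) : 'rV[R]_m.+1 := \row_i partial i F x.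

Definition euclid_div (R : realType) (m : nat)
    (X : 'rV[R]_m.+1 -> 'rV[R]_m.+1) (x : 'rV[R]_m.+1) : R :=
  \sum_i partial i (fun y => X y 0 i) x.

Definition euclid_laplacian (R : realType) (m : nat) (F : 'rV[R]_m.+1 -> R) :
  'rV[R]_m.+1 -> R := euclid_div (euclid_grad F).

(* T_p S^m is the orthogonal complement of p; the round metric is the
   restriction of [dot] to it. *)
Definition tangent (R : realType) (m : nat) (p : 'rV[R]_m.+1) :
  set 'rV[R]_m.+1 := [set v | dot p v = 0].

Definition tangent_proj (R : realType) (m : nat) (p v : 'rV[R]_m.+1) :
  'rV[R]_m.+1 := v - dot p v *: p.

(* The curve t |-> exp_p(t v) on S^m: the great circle with initial point p and
   initial velocity v (constant for v = 0, since 0^-1 = 0). *)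
Definition geodesic (R : realType) (m : nat) (p v : 'rV[R]_m.+1) (t : R) :
  'rV[R]_m.+1 :=
  cos (enorm v * t) *: p + (sin (enorm v * t) / enorm v) *: v.

(* d g_p(v), for g a scalar- or vector-valued map on S^m and v in T_p S^m. *)
Definition sphere_diff (R : realType) (m : nat) (V : normedModType R)
    (g : 'rV[R]_m.+1 -> V) (p v : 'rV[R]_m.+1) : V :=
  derive1 (g \o geodesic p v) 0.

(* Riesz representative of d f_p in T_p S^m for the round metric. *)
Definition sphere_grad (R : realType) (m : nat) (f : 'rV[R]_m.+1 -> R)
    (p : 'rV[R]_m.+1) : 'rV[R]_m.+1 :=
  xget 0 [set G | tangent p G /\
                  forall v, tangent p v -> dot G v = sphere_diff f p v].

(* Levi-Civita connection of the metric induced on S^m by R^(m+1): tangential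
   part of the derivative of the field X in the direction v. *)
Definition sphere_nabla (R : realType) (m : nat)
    (X : 'rV[R]_m.+1 -> 'rV[R]_m.+1) (p v : 'rV[R]_m.+1) : 'rV[R]_m.+1 :=
  tangent_proj p (sphere_diff X p v).

(* Trace of the endomorphism v |-> nabla_v X of T_p S^m. It is computed on
   R^(m+1), after extending the endomorphism by 0 on the normal line R p, which
   leaves the trace unchanged. *)
Definition sphere_div (R : realType) (m : nat)
    (X : 'rV[R]_m.+1 -> 'rV[R]_m.+1) (p : 'rV[R]_m.+1) : R :=
  \tr (lin1_mx (fun v => sphere_nabla X p (tangent_proj p v))).

Definition sphere_laplacian (R : realType) (m : nat) (f : 'rV[R]_m.+1 -> R) :
  'rV[R]_m.+1 -> R := sphere_div (sphere_grad f).

Definition normalize (R : realType) (m : nat) (x : 'rV[R]_m.+1) :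
  'rV[R]_m.+1 := (enorm x)^-1 *: x.

(* Main.v *)
(* Put F = f(x/|x|), homogeneous of degree 0 on the cone over U. By the Euler
   identity for F and its derivatives, grad F is tangent to the sphere and the
   normal second derivative of F vanishes on it, so Delta_S f = Delta F on U. As
   Delta F is homogeneous of degree -2, (Delta_S f)(x/|x|) = |x|^2 Delta F(x);
   applying the same identity to Delta_S f,
     Delta_S^2 f = Delta (|x|^2 Delta F)
                 = |x|^2 Delta^2 F + 4 x.grad(Delta F) + 2(m+1) Delta F,
   where the Euler identity gives x.grad(Delta F) = -2 Delta F. *)

Require Import Defs.
From mathcomp Require Import all_boot all_order all_algebra.
From mathcomp Require Import all_classical all_reals all_analysis.
From mathcomp Require Import ring lra.

Set Implicit Arguments.
Unset Strict Implicit.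
Unset Printing Implicit Defensive.

Import Order.TTheory GRing.Theory Num.Theory.
Import numFieldNormedType.Exports.

Local Open Scope classical_set_scope.
Local Open Scope ring_scope.

(** * Differential calculus in normed spaces *)

(** Differentiability depends only on the germ: the first-order expansion of [f] at [x] is also one
    for [g], and uniqueness of the differential identifies ['d g x] with ['d f x]. *)
Lemma near_eq_differentiable (R : numFieldType) (V W : normedModType R)
    (f g : V -> W) (x : V) :
  {near x, f =1 g} -> differentiable f x -> differentiable g x.
Proof.
move=> fg df; have [dfc /eqaddoP dfE] := (diff_locallyP x f).1 df.
have gE : g \o shift x = cst (g x) + 'd f x +o_ 0 id.
  apply/eqaddoP => e e0; have fe := dfE e e0.
  have fg0 : \forall h \near 0, f (h + x) = g (h + x).
    by move: fg; rewrite (near_shift 0) /= subr0.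
  near=> h; rewrite /= !fctE -(near fg0 h)// -(nbhs_singleton fg).
  by near: h.
have dgf := diff_unique dfc gE.
by apply/diff_locallyP; rewrite dgf.
Unshelve. all: by end_near. Qed.

Lemma differentiable_big (R : numFieldType) (V W : normedModType R) (I : Type)
    (r : seq I) (f : I -> V -> W) (x : V) :
  (forall k, differentiable (f k) x) ->
  differentiable (fun y => \sum_(k <- r) f k y) x.
Proof.
move=> df; rewrite (_ : (fun _ => _) = \sum_(k <- r) f k); last first.
  by apply/funext => y; rewrite fct_sumE.
elim/big_ind: _ => [||k _]; [exact: differentiable_cst| |exact: df].
by move=> g h; exact: differentiableD.
Qed.

Lemma derive_comp (R : numFieldType) (U V W : normedModType R)
    (f : V -> W) (g : U -> V) (x v : U) :
  differentiable g x -> differentiable f (g x) ->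
  'D_v (f \o g) x = 'D_('D_v g x) f (g x).
Proof.
move=> dg df; rewrite !deriveE//; last exact: differentiable_comp.
by rewrite diff_comp.
Qed.

Lemma differentiable_row (R : realFieldType) (V : normedModType R) (n : nat)
    (g : V -> 'rV[R]_n) (x : V) :
  (forall k, differentiable (fun y => g y 0 k) x) -> differentiable g x.
Proof.
move=> dg.
have -> : g = \sum_(k < n) (fun y => g y 0 k *: delta_mx 0 k).
  apply/funext => y; rewrite fct_sumE; exact: row_sum_delta.
by apply: differentiable_sum => k; exact: differentiableZl.
Qed.

(** * Rules for partial derivatives *)

Section Partial.
Context {R : realType} {m : nat}.
Implicit Types (F G : 'rV[R]_m.+1 -> R) (x v : 'rV[R]_m.+1).
Implicit Types (W : set 'rV[R]_m.+1).

Lemma derive_partial F x v : differentiable F x ->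
  'D_v F x = \sum_k v 0 k * partial k F x.
Proof.
move=> dF; rewrite deriveE// {1}(row_sum_delta v) linear_sum.
by apply: eq_bigr => k _; rewrite linearZ/= /partial deriveE.
Qed.

Lemma partial_comp (V : normedModType R) F (g : V -> 'rV[R]_m.+1) (x v : V) :
  differentiable g x -> differentiable F (g x) ->
  'D_v (F \o g) x = \sum_k partial k F (g x) * 'D_v (fun y => g y 0 k) x.
Proof.
move=> dg dF; rewrite derive_comp// derive_partial//.
apply: eq_bigr => k _; rewrite derive_mx ?mxE 1?mulrC//.
exact: diff_derivable.
Qed.

Lemma partialD F G i x : differentiable F x -> differentiable G x ->
  partial i (fun y => F y + G y) x = partial i F x + partial i G x.
Proof. by move=> dF dG; rewrite /partial deriveD//; exact: diff_derivable. Qed.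

Lemma partialM F G i x : differentiable F x -> differentiable G x ->
  partial i (fun y => F y * G y) x = F x * partial i G x + G x * partial i F x.
Proof. by move=> dF dG; rewrite /partial deriveM//; exact: diff_derivable. Qed.

Lemma partial_cst (a : R) i x : partial i (fun=> a) x = 0.
Proof. exact: derive_cst. Qed.

Lemma partial_coord i k x : partial i (fun y => y 0 k) x = (k == i)%:R.
Proof.
rewrite /partial; have := @derive_mx R _ 1 m.+1 id x (delta_mx 0 i).
move=> /(_ (@derivable_id _ _ _ _))/rowP/(_ k).
by rewrite derive_id !mxE eqxx.
Qed.

Lemma partial_sum (I : Type) (r : seq I) (H : I -> 'rV[R]_m.+1 -> R) i x :
  (forall k, differentiable (H k) x) ->
  partial i (fun y => \sum_(k <- r) H k y) x = \sum_(k <- r) partial i (H k) x.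
Proof.
move=> dH; elim: r => [|k r ih].
  under [X in partial i X]eq_fun do rewrite big_nil.
  by rewrite big_nil partial_cst.
under [X in partial i X]eq_fun do rewrite big_cons.
rewrite big_cons partialD ?ih//.
exact: differentiable_big.
Qed.

End Partial.

(** * Finite-order smoothness on a set *)

Section SmoothUpto.
Context {R : realType} {m : nat}.
Implicit Types (F G : 'rV[R]_m.+1 -> R) (W : set 'rV[R]_m.+1).

(** A graded form of [smooth_on] that permits induction on the order. Partials of order at most [n]
    must be differentiable, so on an open set the class lies between C^(n+1) and C^n. *)
Fixpoint smooth_upto n W F : Prop :=
  let dF := forall x, W x -> differentiable F x in
  if n is k.+1 then dF /\ forall i, smooth_upto k W (partial i F) else dF.

Lemma smooth_upto_diff n {W F} x :
  smooth_upto n W F -> W x -> differentiable F x.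
Proof. by case: n => [|n] => [|[dF _]]; auto. Qed.

Lemma smooth_uptoW n W F : smooth_upto n.+1 W F -> smooth_upto n W F.
Proof.
elim: n F => [|n ih] F [dF sF]; first exact: dF.
by split=> [|i]; [exact: dF|apply: ih; exact: sF].
Qed.

Lemma smooth_onP W F : smooth_on W F <-> forall n, smooth_upto n W F.
Proof.
split=> [sF n|sF s x Wx].
  elim: n F sF => [|n ih] F sF; first exact: (sF [::]).
  split=> [|i]; first exact: (sF [::]).
  (* [foldr] applies the last index of the list first, so the innermost derivative is split off with
     [rcons]. *)
  by apply: ih => s x Wx; have := sF (rcons s i) x Wx; rewrite foldr_rcons.
elim/last_ind: s F sF => [|s i ih] F sF.
  exact: smooth_upto_diff (sF 0) Wx.
by rewrite foldr_rcons; apply: ih => n; exact: (sF n.+1).2.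
Qed.

(** On an open set, equality on [W] is equality of germs at each point of [W], hence survives
    differentiation. *)
Lemma eq_on_partial W F G i : open W -> (forall x, W x -> F x = G x) ->
  forall x, W x -> partial i F x = partial i G x.
Proof.
move=> oW FG x Wx; apply: near_eq_derive.
by apply: filterS (open_nbhs_nbhs (conj oW Wx)) => y; exact: FG.
Qed.

Lemma eq_smooth_upto n W F G : open W -> (forall x, W x -> F x = G x) ->
  smooth_upto n W F -> smooth_upto n W G.
Proof.
move=> oW; elim: n F G => [|n ih] F G FG sF; last split.
- move=> x Wx; apply: (near_eq_differentiable _ (sF x Wx)).
  by apply: filterS (open_nbhs_nbhs (conj oW Wx)) => y; exact: FG.
- move=> x Wx; apply: (near_eq_differentiable _ (sF.1 x Wx)).
  by apply: filterS (open_nbhs_nbhs (conj oW Wx)) => y; exact: FG.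
- by move=> i; apply: ih (sF.2 i); exact: eq_on_partial.
Qed.

Lemma sub_smooth_upto n W W' F : W' `<=` W ->
  smooth_upto n W F -> smooth_upto n W' F.
Proof.
move=> W'W; elim: n F => [|n ih] F sF; first by move=> x /W'W; exact: sF.
split=> [x /W'W|i]; first exact: sF.1.
by apply: ih; exact: sF.2.
Qed.

Lemma smooth_upto_cst n W (a : R) : smooth_upto n W (fun=> a).
Proof.
elim: n a => [|n ih] a; first by move=> x _; exact: differentiable_cst.
split=> [x _|i]; first exact: differentiable_cst.
by rewrite (_ : partial i _ = fun=> 0)//; apply/funext => x; exact: partial_cst.
Qed.

Lemma smooth_upto_coord n W (k : 'I_m.+1) : smooth_upto n W (fun y => y 0 k).
Proof.
case: n => [|n]; first by move=> x _; exact: differentiable_coord.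
split=> [x _|i]; first exact: differentiable_coord.
rewrite (_ : partial i _ = fun=> (k == i)%:R); first exact: smooth_upto_cst.
by apply/funext => x; exact: partial_coord.
Qed.

Section Open.
Context {W : set 'rV[R]_m.+1} (oW : open W).

Lemma smooth_uptoD n F G : smooth_upto n W F -> smooth_upto n W G ->
  smooth_upto n W (fun y => F y + G y).
Proof.
elim: n F G => [|n ih] F G sF sG.
  by move=> x Wx; exact: differentiableD (sF x Wx) (sG x Wx).
split=> [x Wx|i]; first exact: differentiableD (sF.1 x Wx) (sG.1 x Wx).
apply: eq_smooth_upto oW _ (ih _ _ (sF.2 i) (sG.2 i)) => x Wx.
by rewrite partialD//; [exact: sF.1|exact: sG.1].
Qed.

Lemma smooth_uptoM n F G : smooth_upto n W F -> smooth_upto n W G ->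
  smooth_upto n W (fun y => F y * G y).
Proof.
elim: n F G => [|n ih] F G sF sG.
  by move=> x Wx; exact: differentiableM (sF x Wx) (sG x Wx).
split=> [x Wx|i]; first exact: differentiableM (sF.1 x Wx) (sG.1 x Wx).
(* In the Leibniz rule the undifferentiated factors are lowered by one order to match their
   differentiated partners. *)
have := smooth_uptoD (ih _ _ (smooth_uptoW sF) (sG.2 i))
                           (ih _ _ (smooth_uptoW sG) (sF.2 i)).
apply: eq_smooth_upto oW _ => x Wx.
by rewrite partialM//; [exact: sF.1|exact: sG.1].
Qed.

Lemma smooth_upto_sum n (I : Type) (r : seq I) (H : I -> 'rV[R]_m.+1 -> R) :
  (forall k, smooth_upto n W (H k)) ->
  smooth_upto n W (fun y => \sum_(k <- r) H k y).
Proof.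
move=> sH; elim: r => [|k r ih].
  under eq_fun do rewrite big_nil; exact: smooth_upto_cst.
by under eq_fun do rewrite big_cons; exact: smooth_uptoD.
Qed.

Lemma smooth_upto_comp n V F (g : 'rV[R]_m.+1 -> 'rV[R]_m.+1) :
  (forall x, W x -> V (g x)) ->
  smooth_upto n V F -> (forall k, smooth_upto n W (fun y => g y 0 k)) ->
  smooth_upto n W (F \o g).
Proof.
move=> gV sF sg.
have dg x : W x -> differentiable g x.
  move=> Wx; apply: differentiable_row => k.
  exact: smooth_upto_diff (sg k) Wx.
have dc : forall G, (forall x, V x -> differentiable G x) ->
    forall x, W x -> differentiable (G \o g) x.
  by move=> G dG x Wx; apply: differentiable_comp; [exact: dg|exact/dG/gV].
elim: n F sF sg => [|n ih] F sF sg; first exact: dc sF.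
split=> [|i]; first exact: dc sF.1.
(* The terms of the chain rule: the outer factor is handled by induction, with [partial k F] in
   place of [F], and the product by [smooth_uptoM]. *)
pose H (k : 'I_m.+1) y := (partial k F \o g) y * partial i (fun y => g y 0 k) y.
have sH k : smooth_upto n W (H k).
  apply: smooth_uptoM; last exact: (sg k).2.
  by apply: ih; [exact: sF.2|move=> l; exact/smooth_uptoW/sg].
apply: eq_smooth_upto oW _ (smooth_upto_sum (index_enum 'I_m.+1) sH).
by move=> x Wx; rewrite [RHS]partial_comp//; [exact: dg|exact/sF.1/gV].
Qed.

End Open.
End SmoothUpto.

(** * The Euclidean norm and radial projection *)

Section Normalize.
Context {R : realType} {m : nat}.
Implicit Types (x y : 'rV[R]_m.+1) (F : 'rV[R]_m.+1 -> R).

Lemma dot_ge0 x : 0 <= dot x x.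
Proof. by apply: sumr_ge0 => i _; exact: sqr_ge0. Qed.

Lemma dot_gt0 x : x != 0 -> 0 < dot x x.
Proof.
move=> x0; rewrite lt_neqAle dot_ge0 andbT eq_sym; apply: contra x0.
rewrite psumr_eq0 => [/allP xx|i _]; last exact: sqr_ge0.
apply/eqP/rowP => i; rewrite mxE; apply/eqP.
by have := xx i (mem_index_enum i); rewrite mulf_eq0 orbb.
Qed.

Lemma dotC x y : dot x y = dot y x.
Proof. by apply: eq_bigr => i _; rewrite mulrC. Qed.

Lemma dotDr x y z : dot x (y + z) = dot x y + dot x z.
Proof. by rewrite -big_split; apply: eq_bigr => i _; rewrite mxE mulrDr. Qed.

Lemma dotZr (a : R) x y : dot x (a *: y) = a * dot x y.
Proof. by rewrite mulr_sumr; apply: eq_bigr => i _; rewrite mxE mulrCA. Qed.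

Lemma dotDl x y z : dot (y + z) x = dot y x + dot z x.
Proof. by rewrite !(dotC _ x) dotDr. Qed.

Lemma dotZl (a : R) x y : dot (a *: y) x = a * dot y x.
Proof. by rewrite !(dotC _ x) dotZr. Qed.

Lemma enorm_gt0 x : x != 0 -> 0 < enorm x.
Proof. by move=> /dot_gt0; rewrite sqrtr_gt0. Qed.

Lemma enorm_sqr x : enorm x ^+ 2 = dot x x.
Proof. exact/sqr_sqrtr/dot_ge0. Qed.

Lemma enorm0 : enorm (0 : 'rV[R]_m.+1) = 0.
Proof.
by rewrite /enorm /dot big1 ?sqrtr0// => i _; rewrite mxE mul0r.
Qed.

Lemma sphereE x : sphere R m x <-> dot x x = 1.
Proof.
rewrite -enorm_sqr /sphere /=; split=> [->|/eqP]; first by rewrite expr1n.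
rewrite sqrf_eq1 => /orP[/eqP//|/eqP x1].
by have := sqrtr_ge0 (dot x x); rewrite -/(enorm x) x1 ler0N1.
Qed.

Lemma sphere_neq0 x : sphere R m x -> x != 0.
Proof.
move=> x1; apply/eqP => x0; move: x1; rewrite /sphere /= x0 enorm0 => /eqP.
by rewrite eq_sym oner_eq0.
Qed.

Lemma enormZ (c : R) x : 0 < c -> enorm (c *: x) = c * enorm x.
Proof.
move=> c0; rewrite /enorm dotZl dotZr mulrA -expr2 sqrtrM ?sqr_ge0//.
by rewrite sqrtr_sqr gtr0_norm.
Qed.

Lemma normalizeZ (c : R) x : 0 < c -> normalize (c *: x) = normalize x.
Proof.
move=> c0; rewrite /normalize enormZ// scalerA invfM mulrAC.
by rewrite mulVf ?mul1r ?gt_eqF.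
Qed.

Lemma normalize_id x : sphere R m x -> normalize x = x.
Proof. by move=> x1; rewrite /normalize x1 invr1 scale1r. Qed.

Lemma sphere_normalize x : x != 0 -> sphere R m (normalize x).
Proof.
move=> x0; rewrite /sphere /= enormZ ?invr_gt0 ?enorm_gt0// mulVf//.
by rewrite gt_eqF// enorm_gt0.
Qed.

Lemma differentiable_dot x : differentiable (fun y => dot y y) x.
Proof.
apply: differentiable_big => k.
by apply: differentiableM; exact: differentiable_coord.
Qed.

Lemma partial_dot i x : partial i (fun y => dot y y) x = 2 * x 0 i.
Proof.
rewrite /dot partial_sum => [|k]; last first.
  by apply: differentiableM; exact: differentiable_coord.
rewrite (bigD1 i)//= big1 => [|k ki].
  rewrite partialM; try exact: differentiable_coord.
  by rewrite partial_coord eqxx /=; ring.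
rewrite partialM; try exact: differentiable_coord.
by rewrite partial_coord (negbTE ki) /=; ring.
Qed.

Lemma differentiable_enorm x : x != 0 -> differentiable (@enorm R m.+1) x.
Proof.
move=> x0; apply: (@differentiable_comp _ _ _ _ (fun y => dot y y)).
  exact: differentiable_dot.
by apply/derivable1_diffP; have [] := is_derive1_sqrt (dot_gt0 x0).
Qed.

Lemma differentiable_invenorm x : x != 0 ->
  differentiable (fun y => (enorm y)^-1) x.
Proof.
move=> x0; apply: differentiableV; first exact: differentiable_enorm.
by rewrite gt_eqF ?enorm_gt0.
Qed.

(** Differentiating |y|^2 as the product |y| |y| gives 2 |x| times the partial on one side and 2 x_i
    on the other; |x| is then cancelled. *)
Lemma partial_enorm i x : x != 0 ->
  partial i (@enorm R m.+1) x = x 0 i / enorm x.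
Proof.
move=> x0; have := partial_dot i x.
rewrite (_ : (fun y => dot y y) = (fun y => enorm y * enorm y)); last first.
  by apply/funext => y; rewrite -expr2 enorm_sqr.
rewrite partialM; try exact: differentiable_enorm.
have := enorm_gt0 x0 => n0 h; apply: (mulfI (lt0r_neq0 n0)).
by rewrite mulrCA divff ?gt_eqF//; lra.
Qed.

Lemma partial_invenorm i x : x != 0 ->
  partial i (fun y => (enorm y)^-1) x = - x 0 i * (enorm x)^-1 ^+ 3.
Proof.
move=> x0; have n0 : enorm x != 0 by rewrite gt_eqF ?enorm_gt0.
rewrite /partial deriveV//; last exact/diff_derivable/differentiable_enorm.
by rewrite -/(partial i _ x) partial_enorm// /GRing.scale/=; field.
Qed.

Lemma open_neq0 : open [set x : 'rV[R]_m.+1 | x != 0].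
Proof.
rewrite (_ : [set _ | _] = ~` [set 0]); last first.
  by apply/seteqP; split=> x /eqP.
exact/closed_openC/accessible_closed_set1/hausdorff_accessible/norm_hausdorff.
Qed.

(** The derivative - y_i |y|^-3 is a polynomial in a coordinate and |y|^-1 itself, so the induction
    on the order closes. *)
Lemma smooth_upto_invenorm n :
  smooth_upto n [set x : 'rV[R]_m.+1 | x != 0] (fun y => (enorm y)^-1).
Proof.
elim: n => [|n ih]; first exact: differentiable_invenorm.
split=> [|i]; first exact: differentiable_invenorm.
have s3 := smooth_uptoM open_neq0 ih
  (smooth_uptoM open_neq0 ih
    (smooth_uptoM open_neq0 ih (smooth_upto_cst n _ (-1)))).
have := smooth_uptoM open_neq0 (smooth_upto_coord n _ i) s3.
apply: eq_smooth_upto open_neq0 _ => x x0.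
by rewrite partial_invenorm//; ring.
Qed.

Lemma smooth_upto_normalize n k :
  smooth_upto n [set x : 'rV[R]_m.+1 | x != 0] (fun y => normalize y 0 k).
Proof.
rewrite (_ : (fun _ => _) = fun y => (enorm y)^-1 * y 0 k); last first.
  by apply/funext => y; rewrite mxE.
apply: (smooth_uptoM open_neq0 (smooth_upto_invenorm n)).
exact: smooth_upto_coord.
Qed.

Lemma normalize_continuous x : x != 0 -> {for x, continuous (@normalize R m)}.
Proof.
move=> x0; apply/differentiable_continuous/differentiable_row => k.
exact: (smooth_upto_diff (smooth_upto_normalize 0 k)).
Qed.

End Normalize.

(** * Cones and degree-0 extensions *)

Section Cone.
Context {R : realType} {m : nat}.
Implicit Types (x y p v : 'rV[R]_m.+1) (F f : 'rV[R]_m.+1 -> R).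
Implicit Types (U W : set 'rV[R]_m.+1).

(** For [U] in the sphere this is the domain of f(x/|x|). The apex is excluded explicitly because
    [normalize 0] is 0, which may lie in a general set [U]. *)
Definition cone U : set 'rV[R]_m.+1 := [set x | x != 0 /\ U (normalize x)].

Lemma open_cone_open O : open O -> open (cone O).
Proof.
move=> oO; rewrite openE => x [x0 Ox].
apply: filterI; first exact: open_nbhs_nbhs (conj open_neq0 x0).
by apply: (normalize_continuous x0); exact: open_nbhs_nbhs.
Qed.

Lemma open_cone U : open_in_sphere U -> open (cone U).
Proof.
move=> [V oV ->]; rewrite (_ : cone _ = cone V); first exact: open_cone_open.
apply/seteqP; split=> x [x0]; first by case.
by split=> //; split=> //; exact: sphere_normalize.
Qed.

Lemma sub_cone U p : open_in_sphere U -> U p -> cone U p.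
Proof.
move=> [V _ ->] [Op p1]; split; first exact: sphere_neq0.
by rewrite normalize_id.
Qed.

Lemma coneZ U (c : R) x : 0 < c -> cone U x -> cone U (c *: x).
Proof.
move=> c0 [x0 Ux]; split; last by rewrite normalizeZ.
by rewrite scaler_eq0 negb_or gt_eqF.
Qed.

Lemma smooth_upto_local n W F :
  (forall x, W x -> exists V, [/\ open V, V x & smooth_upto n V F]) ->
  smooth_upto n W F.
Proof.
elim: n F => [|n ih] F sF.
  by move=> x /sF[V [_ Vx]] dF; exact: dF.
split=> [x /sF[V [_ Vx]]|i]; first by case=> dF _; exact: dF.
by apply: ih => x /sF[V [oV Vx [_ sV]]]; exists V; split=> //; exact: sV.
Qed.

(** Near a point of the cone, [f] can be replaced by a local smooth extension [F], and
    [F \o normalize] is a composite of smooth maps. The neighbourhood varies with the point, hence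
    [smooth_upto_local]. *)
Lemma smooth_upto_normalize_comp n U f : open_in_sphere U ->
  sphere_smooth_on U f -> smooth_upto n (cone U) (f \o @normalize R m).
Proof.
move=> oU sf; apply: smooth_upto_local => x Ux.
have [V [F [oV Vx /smooth_onP sF Ff]]] := sf _ Ux.2.
have oI : open (cone U `&` cone V).
  by apply: openI; [exact: open_cone|exact: open_cone_open].
exists (cone U `&` cone V); split=> //.
  by split=> //; split=> //; exact: Ux.1.
apply: (@eq_smooth_upto _ _ n _ (F \o @normalize R m)) => //.
  by move=> y [[_ Uy] [_ Vy]]; exact: Ff.
apply: smooth_upto_comp (sF n) _ => // [y [_ []]//|k].
by apply: sub_smooth_upto (smooth_upto_normalize n k) => y [[]].
Qed.

(** * Homogeneous functions and the Euler identity *)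

(** Positive homogeneity of degree -k. Starting from degree 0, each derivative lowers the degree by
    one, so a natural number records it. *)
Definition homogeneous_opp (k : nat) W F :=
  forall (c : R) y, 0 < c -> W y -> F (c *: y) = c^-1 ^+ k * F y.

Section Homogeneous.
Context {U : set 'rV[R]_m.+1} (oU : open (cone U)).

Lemma homogeneous_partial k F i : homogeneous_opp k (cone U) F ->
  (forall x, cone U x -> differentiable F x) ->
  homogeneous_opp k.+1 (cone U) (partial i F).
Proof.
move=> hF dF c x c0 Ux.
have dFc : differentiable F (c *: x) by exact/dF/coneZ.
(* Chain rule for the dilation by [c]: it contributes a factor c, whose inverse raises c^-k to
   c^-(k+1). *)
have <- : c^-1 * partial i (F \o *:%R c) x = partial i F (c *: x).
  rewrite /partial derive_comp// deriveZ// derive_id !deriveE// linearZ/=.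
  by rewrite mulKf ?gt_eqF.
rewrite (eq_on_partial (G := fun y => c^-1 ^+ k * F y) _ oU)//; last first.
  by move=> y Uy; exact: hF.
by rewrite [in LHS]/partial deriveMl ?exprS ?mulrA//; exact/diff_derivable/dF.
Qed.

(** Both sides are the derivative at t = 1 of F(t x) = t^-k F(x): the left one by the chain rule,
    the right one by the power rule. *)
Lemma euler_identity k F x : homogeneous_opp k (cone U) F ->
  differentiable F x -> cone U x ->
  \sum_i x 0 i * partial i F x = - k%:R * F x.
Proof.
move=> hF dF Ux; rewrite -derive_partial//.
have dx : differentiable (fun t : R => t *: x) (1 : R) by [].
have Dx : 'D_1 (fun t : R => t *: x) (1 : R) = x.
  by rewrite deriveE// diff_val scale1r.
have dV : is_derive (1 : R) 1 (fun t : R => t^-1) (- 1).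
  apply: DeriveDef; first by apply: derivableV; rewrite ?oner_eq0.
  by rewrite deriveV ?oner_eq0// derive_id expr1n invr1 scaleN1r.
have := @derive_comp _ _ _ _ F (fun t : R => t *: x) (1 : R) 1 dx.
rewrite scale1r Dx => <-//.
(* Homogeneity is available only for t > 0, which holds near t = 1. *)
rewrite (near_eq_derive (g := fun t : R => F x * t^-1 ^+ k)); last first.
  near=> t; have t0 : 0 < t by near: t; exact: (cvgr_gt (1 : R) cvg_id 0 ltr01).
  by rewrite mulrC /= hF.
have dX : is_derive (1 : R) 1 (fun t : R => t^-1 ^+ k) (- k%:R).
  rewrite (_ : (fun t => _) = (fun t : R => t^-1) ^+ k); last first.
    by apply/funext => t; rewrite exprfctE.
  apply: (is_derive_eq (is_deriveX k dV)).
  by rewrite invr1 expr1n mulr1 /GRing.scale/= mulrN1.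
by rewrite deriveMl// derive_val mulrC.
Unshelve. all: by end_near. Qed.

End Homogeneous.

(** * The Euclidean Laplacian *)

Lemma euclid_laplacianE F x :
  euclid_laplacian F x = \sum_i partial i (partial i F) x.
Proof.
by apply: eq_bigr => i _; congr partial; apply/funext => y; rewrite mxE.
Qed.

Lemma eq_on_laplacian W F G : open W -> (forall x, W x -> F x = G x) ->
  forall x, W x -> euclid_laplacian F x = euclid_laplacian G x.
Proof.
move=> oW FG x Wx; rewrite !euclid_laplacianE; apply: eq_bigr => i _.
by apply: (eq_on_partial _ oW) => // y Wy; exact: (eq_on_partial _ oW).
Qed.

Lemma smooth_upto_laplacian n W F : open W -> smooth_upto n.+2 W F ->
  smooth_upto n W (euclid_laplacian F).
Proof.
move=> oW [_ sF].
rewrite (_ : euclid_laplacian F = fun x => \sum_i partial i (partial i F) x);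
    last first.
  by apply/funext => x; exact: euclid_laplacianE.
by apply: smooth_upto_sum => // i; exact: (sF i).2.
Qed.

Lemma homogeneous_laplacian k U F : open (cone U) ->
  smooth_upto 1 (cone U) F -> homogeneous_opp k (cone U) F ->
  homogeneous_opp k.+2 (cone U) (euclid_laplacian F).
Proof.
move=> oU [dF sF] hF c x c0 Ux; rewrite !euclid_laplacianE mulr_sumr.
apply: eq_bigr => i _; have hi := homogeneous_partial oU i hF dF.
exact: (homogeneous_partial oU i hi (sF i)).
Qed.

(** Leibniz rule with grad |y|^2 = 2y, giving the cross term 2 (2x).grad F, and Laplacian of |y|^2
    equal to 2(m+1). *)
Lemma laplacian_dotM W F x : open W -> smooth_upto 1 W F -> W x ->
  euclid_laplacian (fun y => dot y y * F y) x =
  dot x x * euclid_laplacian F x + 4 * (\sum_i x 0 i * partial i F x)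
  + 2 * m.+1%:R * F x.
Proof.
move=> oW [dF sF] Wx; rewrite !euclid_laplacianE.
have dd y : differentiable (fun y => dot y y : R) y.
  exact: differentiable_dot.
have dy y k : differentiable (fun y => y 0 k : R) y.
  exact: differentiable_coord.
transitivity (\sum_i (dot x x * partial i (partial i F) x +
    4 * (x 0 i * partial i F x) + 2 * F x)); last first.
  by rewrite !big_split/= -!mulr_sumr sumr_const card_ord -mulr_natr; ring.
apply: eq_bigr => i _.
rewrite (eq_on_partial
    (G := fun y => dot y y * partial i F y + F y * (2 * y 0 i)) _ oW)//;
    last first.
  by move=> y Wy; rewrite partialM ?partial_dot//; exact: dF.
have d2 : differentiable (fun y => 2 * y 0 i : R) x.
  exact: (differentiableM (differentiable_cst _ _)).
rewrite partialD; last first.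
- by apply: differentiableM => //; exact: dF.
- by apply: differentiableM => //; exact: sF.
rewrite !partialM ?partial_dot ?partial_cst ?partial_coord ?eqxx//=;
  try exact: differentiable_cst.
- by ring.
- exact: dF.
- exact: sF.
Qed.

End Cone.

(* With [P = 1 - q^T q] this reads [tr (P H P) = tr H]; the two hypotheses are
   the Euler identity and its derivative. *)
Lemma trace_tangent_proj (R : comRingType) (n : nat) (g q : 'I_n -> R)
    (H : 'I_n -> 'I_n -> R) :
  \sum_k q k * g k = 0 -> (forall l, \sum_k q k * H l k = - g l) ->
  \sum_i (\sum_l ((l == i)%:R - q i * q l) * H l i -
    (\sum_k q k * \sum_l ((l == i)%:R - q i * q l) * H l k) * q i) =
  \sum_i H i i.
Proof.
move=> qg qH.
have E i (z : 'I_n -> R) : \sum_l ((l == i)%:R - q i * q l) * z l =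
    z i - q i * \sum_l q l * z l.
  under eq_bigr do rewrite mulrBl -mulrA.
  rewrite sumrB mulr_sumr (bigD1 i)//= eqxx mul1r big1 ?addr0// => l /negbTE ->.
  by rewrite mul0r.
(* Summing over [k] first turns H q into -g, and the projection fixes g because q.g = 0. *)
have E2 i : \sum_k q k * \sum_l ((l == i)%:R - q i * q l) * H l k = - g i.
  under eq_bigr do rewrite mulr_sumr.
  rewrite exchange_big/=.
  under eq_bigr => l _.
    rewrite (eq_bigr (fun k => ((l == i)%:R - q i * q l) * (q k * H l k)));
      last by move=> k _; ring.
    rewrite -mulr_sumr qH.
  over.
  rewrite E; under eq_bigr do rewrite mulrN.
  by rewrite sumrN qg oppr0 mulr0 subr0.
(* Both corrections to the trace vanish: the last sums to q.g, and the middle one does so up to sign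
   after H q = -g is applied. *)
transitivity (\sum_i (H i i - \sum_l q l * (q i * H l i) + q i * g i)).
  apply: eq_bigr => i _; rewrite E E2 mulr_sumr.
  rewrite mulNr opprK (mulrC (g i)); congr (_ - _ + _).
  by apply: eq_bigr => l _; ring.
rewrite big_split/= qg addr0 sumrB exchange_big/=.
under [X in _ - X]eq_bigr do rewrite -mulr_sumr qH mulrN.
by rewrite sumrN qg oppr0 subr0.
Qed.

(** * Great circles and differentiation along the sphere *)

Section Sphere.
Context {R : realType} {m : nat}.
Implicit Types (x y p v : 'rV[R]_m.+1) (f : 'rV[R]_m.+1 -> R).

Lemma sphere_geodesic p v t :
  sphere R m p -> tangent p v -> sphere R m (geodesic p v t).
Proof.
move=> p1 pv; apply/sphereE; rewrite /geodesic !(dotDl, dotDr, dotZl, dotZr).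
rewrite (dotC v p) pv (sphereE p).1// -(enorm_sqr v).
(* The cross terms are gone by tangency. If v = 0 the remaining sine term carries the factor |v|^2 =
   0; otherwise |v|^2 cancels its denominator. *)
have [v0|v0] := eqVneq (enorm v) 0.
  by rewrite v0 mul0r cos0; ring.
rewrite -[RHS](cos2Dsin2 (enorm v * t)); field.
exact: v0.
Qed.

Lemma is_derive_geodesic p v : is_derive (0 : R) 1 (geodesic p v) v.
Proof.
have D k : is_derive (0 : R) 1 (fun t => geodesic p v t 0 k) (v 0 k).
  rewrite (_ : (fun t => _) = fun t => cos (enorm v * t) * p 0 k +
      sin (enorm v * t) * (v 0 k / enorm v)); last first.
    by apply/funext => t; rewrite !mxE; ring.
  have De : is_derive (0 : R) 1 (fun t => enorm v * t) (enorm v).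
    by apply: is_derive_eq; rewrite /GRing.scale/= mulr1.
  have Dc := is_derive1_comp (is_derive_cos (enorm v * 0)) De.
  have Ds := is_derive1_comp (is_derive_sin (enorm v * 0)) De.
  have Dc' := is_deriveM Dc (is_derive_cst (p 0 k) (0 : R) (1 : R)).
  have Ds' := is_deriveM Ds (is_derive_cst (v 0 k / enorm v) (0 : R) (1 : R)).
  apply: (is_derive_eq (is_deriveD Dc' Ds')).
  rewrite /= /GRing.scale /= (mulr0 (enorm v)) cos0 sin0.
  (* The velocity at 0 is (|v|/|v|) v. The quotient is 1 unless v = 0, when it is 0 by convention
     and v vanishes anyway. *)
  have [/eqP|v0] := eqVneq (enorm v) 0.
    rewrite sqrtr_eq0 => v0; suff -> : v = 0 by rewrite mxE; ring.
    by apply/eqP; apply: contraLR v0 => /dot_gt0; rewrite ltNge.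
  by field.
have dg : derivable (geodesic p v) 0 1.
  by apply/derivable_mxP => i k; rewrite ord1; case: (D k).
apply: DeriveDef => //; rewrite derive_mx//; apply/rowP => k.
by rewrite mxE derive_val.
Qed.

Lemma geodesic0 p v : geodesic p v 0 = p.
Proof. by rewrite /geodesic mulr0 cos0 sin0 mul0r scale1r scale0r addr0. Qed.

Section Domain.
Context {U : set 'rV[R]_m.+1} (oU : open_in_sphere U).

(** The geodesic stays on the sphere and, by continuity, in [U] for small t, so [g] may be replaced
    by [G] along it. The chain rule with initial velocity [v] then gives a Euclidean directional
    derivative. *)
Lemma sphere_diffE (V : normedModType R) (g G : 'rV[R]_m.+1 -> V) p v :
  U p -> tangent p v -> (forall x, U x -> g x = G x) ->
  differentiable G p -> sphere_diff g p v = 'D_v G p.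
Proof.
move=> Up pv gG dG.
have Dg := is_derive_geodesic p v.
have dg : differentiable (geodesic p v) 0.
  by apply/derivable1_diffP; case: Dg.
have [W oW UE] := oU.
have [Wp p1] : W p /\ sphere R m p by move: Up; rewrite UE.
rewrite /sphere_diff derive1E (near_eq_derive (g := G \o geodesic p v)).
  by rewrite derive_comp ?geodesic0// derive_val.
have : \forall t \near (0 : R), W (geodesic p v t).
  apply: (differentiable_continuous dg); rewrite geodesic0.
  exact: open_nbhs_nbhs.
apply: filterS => t Wt; apply: gG; rewrite UE; split=> //.
exact: sphere_geodesic.
Qed.

(** * Spherical gradient and Laplacian via the degree-0 extension *)

Section Laplacian.
Context {g : 'rV[R]_m.+1 -> R}.
Let G := g \o @normalize R m.
Context (sG : smooth_upto 1 (cone U) G).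

Let gE x : U x -> g x = G x.
Proof.
case: oU => W _ -> [_ x1].
by rewrite /G/= normalize_id.
Qed.

Lemma homogeneous_comp_normalize : homogeneous_opp 0 (cone U) G.
Proof. by move=> c y c0 _; rewrite expr0 mul1r /G/= normalizeZ. Qed.

Lemma euler_comp_normalize x : cone U x -> \sum_k x 0 k * partial k G x = 0.
Proof.
move=> Ux; rewrite (euler_identity homogeneous_comp_normalize)//.
  by rewrite oppr0 mul0r.
exact: sG.1.
Qed.

Lemma sphere_gradE p : U p -> sphere_grad g p = euclid_grad G p.
Proof.
move=> Up; have Cp := sub_cone oU Up.
have dotE v : dot (euclid_grad G p) v = 'D_v G p.
  rewrite derive_partial; last exact: sG.1.
  by apply: eq_bigr => k _; rewrite mxE mulrC.
have GP : tangent p (euclid_grad G p) /\ forall v, tangent p v ->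
    dot (euclid_grad G p) v = sphere_diff g p v.
  split=> [|v pv]; last by rewrite dotE (sphere_diffE (G := G))//; exact: sG.1.
  rewrite /tangent /= -[RHS](euler_comp_normalize Cp).
  by apply: eq_bigr => k _; rewrite mxE.
(* Uniqueness of the Riesz representative: the difference of two candidates is tangent, so pairing
   it with itself gives 0, contradicting positivity unless it vanishes. *)
apply: xget_unique => // X [tX XP]; apply/eqP; rewrite -subr_eq0.
apply: contraT => /dot_gt0.
have tD : tangent p (X - euclid_grad G p).
  by rewrite /tangent/= -scaleN1r dotDr dotZr tX GP.1 mulr0 addr0.
by rewrite {1}(dotDl) -scaleN1r dotZl scaleN1r XP// GP.2// mulN1r subrr ltxx.
Qed.

(** Obtained by applying the l-th partial to the Euler identity, which holds on the whole open
    cone. *)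
Lemma partial_euler p l : cone U p ->
  \sum_k p 0 k * partial l (partial k G) p = - partial l G p.
Proof.
move=> Cp.
have := eq_on_partial (G := fun=> 0) l (open_cone oU) euler_comp_normalize Cp.
rewrite partial_cst partial_sum => [|k]; last first.
  apply: differentiableM; first exact: differentiable_coord.
  exact: (sG.2 k).
under eq_bigr => k _.
  rewrite partialM; [|exact: differentiable_coord|exact: (sG.2 k)].
  rewrite partial_coord.
over.
rewrite big_split/= => /eqP; rewrite addr_eq0 => /eqP ->; congr (- _).
rewrite (bigD1 l)//= big1 ?eqxx ?mulr1 ?addr0// => k /negbTE ->.
by rewrite mulr0.
Qed.

(** The covariant derivative of the gradient, extended by 0 on the normal line, is P H P with H the
    Hessian of [G] at [p] and P the tangential projection. The Euler relations make its trace equal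
    to tr H. *)
Lemma sphere_laplacianE p : U p -> sphere_laplacian g p = euclid_laplacian G p.
Proof.
move=> Up; have Cp := sub_cone oU Up.
have p1 : dot p p = 1.
  by apply/sphereE; case: oU Up => W _ -> [].
have dgrad : differentiable (euclid_grad G) p.
  apply: differentiable_row => k.
  rewrite (_ : (fun y => _) = partial k G); last first.
    by apply/funext => y; rewrite mxE.
  exact: (sG.2 k).
have gradE w k : 'D_w (euclid_grad G) p 0 k =
      \sum_l w 0 l * partial l (partial k G) p.
  rewrite derive_mx; last exact: diff_derivable.
  rewrite mxE (_ : (fun y => _) = partial k G); last first.
    by apply/funext => y; rewrite mxE.
  by rewrite derive_partial//; exact: (sG.2 k).
rewrite euclid_laplacianE.
rewrite -(@trace_tangent_proj _ _ (fun k => partial k G p) (fun k => p 0 k)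
    (fun l k => partial l (partial k G) p)); last 2 first.
- exact: euler_comp_normalize.
- by move=> l; exact: partial_euler.
apply: eq_bigr => i _; rewrite mxE.
(* [w] is the projection of the i-th basis vector, so the i-th diagonal entry of the matrix
   differentiates the gradient along [w]. *)
set w := tangent_proj p _.
have wE l : w 0 l = (l == i)%:R - p 0 i * p 0 l.
  rewrite /w !mxE eqxx/=; congr (_ - _ * _).
  rewrite /dot (bigD1 i)//= big1 ?mxE ?eqxx ?mulr1 ?addr0// => k /negbTE ki.
  by rewrite mxE ki mulr0.
have tw : tangent p w.
  rewrite /tangent /w /= /tangent_proj -scaleN1r dotDr !dotZr p1; ring.
rewrite /sphere_nabla (sphere_diffE (G := euclid_grad G))//; last first.
  exact: sphere_gradE.
rewrite !mxE gradE; congr (_ - _ * _).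
  by apply: eq_bigr => l _; rewrite wE.
apply: eq_bigr => k _; rewrite gradE; congr (_ * _).
by apply: eq_bigr => l _; rewrite wE.
Qed.

End Laplacian.
End Domain.
End Sphere.

(** * The bi-Laplacian identity *)

Unset Implicit Arguments.

Theorem theorem2p1 (R : realType) (m : nat) (U : set 'rV[R]_m.+1)
    (f : 'rV[R]_m.+1 -> R)
    (hU : open_in_sphere U) (hf : sphere_smooth_on U f) :
  (forall x : 'rV[R]_m.+1, U x ->
     sphere_laplacian (sphere_laplacian f) x =
     euclid_laplacian (euclid_laplacian (f \o @normalize R m)) x
     + 2 * (m%:R - 3) * sphere_laplacian f x)
  /\
  (forall x : 'rV[R]_m.+1, U x ->
     sphere_laplacian (sphere_laplacian f) x =
     euclid_laplacian (euclid_laplacian (f \o @normalize R m)) x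
     + 2 * (m%:R - 3) * euclid_laplacian (f \o @normalize R m) x).
Proof.
have oC := open_cone hU.
have sF n := smooth_upto_normalize_comp n hU hf.
set F := f \o @normalize R m.
have fE x : U x -> sphere_laplacian f x = euclid_laplacian F x.
  exact: (sphere_laplacianE hU (sF 1%N)).
suff main x : U x -> sphere_laplacian (sphere_laplacian f) x =
    euclid_laplacian (euclid_laplacian F) x
    + 2 * (m%:R - 3) * euclid_laplacian F x.
  by split=> x Ux; rewrite main// fE.
move=> Ux; have Cx := sub_cone hU Ux.
have h2 : homogeneous_opp 2 (cone U) (euclid_laplacian F).
  apply: homogeneous_laplacian (sF 1%N) _ => //.
  exact: homogeneous_comp_normalize.
(* Degree -2 homogeneity with factor 1/|y| identifies the degree-0 extension of the spherical
   Laplacian of [f]. *)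
have lapE y : cone U y ->
    dot y y * euclid_laplacian F y = (sphere_laplacian f \o @normalize R m) y.
  move=> [y0 Uy]; rewrite /= fE// [in RHS]/normalize h2 ?invr_gt0 ?enorm_gt0//.
  by rewrite invrK enorm_sqr.
have sL : smooth_upto 1 (cone U) (euclid_laplacian F).
  exact: (smooth_upto_laplacian oC (sF 3)).
have sdot : smooth_upto 1 (cone U) (fun y => dot y y).
  apply: (smooth_upto_sum oC) => k.
  by apply: (smooth_uptoM oC); exact: smooth_upto_coord.
(* The regularity needed for a second use of [sphere_laplacianE] is read off the explicit left side
   of [lapE]. *)
have sG : smooth_upto 1 (cone U) (sphere_laplacian f \o @normalize R m).
  by apply: (eq_smooth_upto oC lapE); exact: (smooth_uptoM oC).
rewrite (sphere_laplacianE hU sG)//.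
rewrite -(eq_on_laplacian oC lapE)// (laplacian_dotM oC)//.
have x1 : dot x x = 1 by apply/sphereE; case: hU Ux => W _ -> [].
(* With x.grad equal to -2 on the Laplacian of [F], the coefficient becomes 4(-2) + 2(m+1) =
   2(m-3). *)
rewrite (euler_identity h2)//; last exact: sL.1.
rewrite x1 -[in m.+1%:R]natr1; ring.
Qed.
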